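(* Assume that $(\mu_\alpha)$ is exponentially tight with respect to $(t_\alpha)$, and that at least one of the following conditions holds: (i) $(\mu_\alpha)$ is $X_0$-exponentially tight with respect to $(t_\alpha)$; (ii) $(\mu_\alpha)$ is exponentially tight with respect to $(t_\alpha)$ and $l_0(x)=+\infty$ for all $x\in X\setminus X_0$; (iii) for all $F\in\mathcal{F}$, for all open covers $\{G_i:i\in I\}$ of $F\cap X_0$ and for all $\varepsilon>0$, there exists a finite set $\{G_{i_1},\dots,G_{i_N}\}\subset\{G_i:i\in I\}$ such that $\limsup\mu_\alpha^{t_\alpha}(F)-\limsup\mu_\alpha^{t_\alpha}\big(\bigcup_{1\le j\le N}\overline{G_{i_j}}\big)<\varepsilon$. Let $\mathcal{A}$ be a set of real-valued continuous functions on $X$ which is either an algebra separating the points of $X$ or a well-separating class. If $\Lambda(h)$ exists for every $h\in\mathcal{A}_{ba}$, then $(\mu_\alpha)$ satisfies a large deviation principle with powers $(t_\alpha)$ and a rate function $J$ verifying $J(x)=+\infty$ for all $x\in X\setminus\overline{X_0}$ and $$\forall x\in X_0,\quad J(x)=\sup_{h\in\mathcal{A}_{ba}}\{h(x)-\Lambda(h)\}=\sup_{h\in\mathcal{A}}\{h(x)-\overline{\Lambda}(h)\}=\sup_{h\in\mathcal{A}}\{h(x)-\underline{\Lambda}(h)\}=\sup_{h\in\mathcal{A}}\{h(x)-\lim_{M\to+\infty}\underline{\Lambda}(h_M)\}.\qquad( * )$$ When $X$ is regular, $( * )$ determines uniquely the rate function by $$\forall x\in X,\quad J(x)=\sup_{G\in\mathcal{G},\,G\ni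 x}\ \inf_{y\in G\cap X_0}J(y).$$ When $\mathcal{A}$ does not vanish identically at any point of $X$ (in particular when $\mathcal{A}$ contains the constants, as in the well-separating case), it is sufficient to assume the existence of $\Lambda(h)$ for every $h\in\mathcal{A}_-$, and $\mathcal{A}_{ba}$ can be replaced by $\mathcal{A}_-$ in $( * )$.
   Context: $X$ is a topological space, not reduced to one point, in which compact sets are Borel sets; no separation axiom is assumed unless stated (''regular'' does not include Hausdorff). $\mathcal{F},\mathcal{G},\mathcal{K}$ denote the sets of closed, open, compact subsets of $X$. $\mathcal{C}(X)$ (resp. $\mathcal{C}_b(X)$) is the set of real-valued continuous (resp. bounded continuous) functions on $X$. $(\mu_\alpha)$ is a net of Borel probability measures on $X$ and $(t_\alpha)$ a net (same index set) in $]0,+\infty[$ converging to $0$. Write $\mu_\alpha^{t_\alpha}(A)=(\mu_\alpha(A))^{t_\alpha}$ for Borel $A$, and for Borel measurable $h:X\to[-\infty,+\infty[$, $\mu_\alpha^{t_\alpha}(e^{h/t_\alpha})=\big(\int_X e^{h(x)/t_\alpha}\mu_\alpha(dx)\big)^{t_\alpha}$. Put $\overline\Lambda(h)=\log\limsup\mu_\alpha^{t_\alpha}(e^{h/t_\alpha})$, $\underline\Lambda(h)=\log\liminf\mu_\alpha^{t_\alpha}(e^{h/t_\alpha})$, and $\Lambda(h)=\log\lim\mu_\alpha^{t_\alpha}(e^{h/t_\alpha})$ when this limit exists (existence is in $[-\infty,+\infty]$ for $\Lambda(h)$). Conventions: $e^{-\infty}=0$, $\log 0=-\infty$, $\inf\emptyset=+\infty$.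 Large deviation principle with powers $(t_\alpha)$: for a function $l:X\to[0,+\infty]$, $\limsup\mu_\alpha^{t_\alpha}(F)\le\sup_{x\in F}e^{-l(x)}$ for all $F\in\mathcal{F}$ and $\sup_{x\in G}e^{-l(x)}\le\liminf\mu_\alpha^{t_\alpha}(G)$ for all $G\in\mathcal{G}$; the lower regularization of $l$ (the greatest lower semi-continuous function $\le l$) is then called a rate function. $l_0(x)=-\log\inf\{\limsup\mu_\alpha^{t_\alpha}(G):G\in\mathcal{G},G\ni x\}$ for $x\in X$. $X_0$ is the set of points $x\in X$ such that for each $G\in\mathcal{G}$ containing $x$, each real $s>0$ and each real $t>0$ there is $h\in\mathcal{C}_b(X)$ with $e^{-t}1_{\{x\}}\le e^h\le 1_G\vee e^{-s}$ pointwise. $(\mu_\alpha)$ is exponentially tight (resp. $X_0$-exponentially tight) with respect to $(t_\alpha)$ if for each $\varepsilon>0$ there is a compact set $K\subset X$ (resp. a compact set $K\subset X_0$) with $\limsup\mu_\alpha^{t_\alpha}(X\setminus K)<\varepsilon$. Algebras are real algebras of functions under pointwise operations, not necessarily unital, and their elements are not assumed bounded. A set $\mathcal{A}\subset\mathcal{C}(X)$ separates the points if for all $x\ne y$ there is $h\in\mathcal{A}$ with $h(x)\neq h(y)$; it does not vanish identically at any point of $X$ if for every $x\in X$ there is $h\in\mathcal{A}$ with $h(x)\ne0$. A well-separating class is a set $\mathcal{A}\subset\mathcal{C}(X)$ which contains the constants, is closed under finite pointwise minima, and such that for all $x\neq y$ in $X$ and all $a,b\in\mathbb{R}$ there is $g\in\mathcal{A}$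 with $g(x)=a$, $g(y)=b$. $\mathcal{A}_{ba}$ is the set of elements of $\mathcal{A}$ that are bounded above, and $\mathcal{A}_-=\{h\in\mathcal{A}:h\le0\}$. For $h\in\mathcal{A}$ and real $M$, $h_M=h1_{\{h<M\}}-\infty1_{\{h\ge M\}}$ (i.e. $h_M=h$ on $\{h<M\}$ and $-\infty$ elsewhere). *)

(* Defs.v *)
From HB Require Import structures.
From mathcomp Require Import all_boot all_order all_algebra.
From mathcomp Require Import all_classical all_reals all_analysis.

Set Implicit Arguments.
Unset Strict Implicit.
Unset Printing Implicit Defensive.

Import Order.TTheory GRing.Theory Num.Theory.
Import numFieldNormedType.Exports.

Local Open Scope classical_set_scope.
Local Open Scope ring_scope.
Local Open Scope ereal_scope.

Definition directed_set (I : Type) (le : I -> I -> Prop) : Prop :=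
  [/\ inhabited I, forall a, le a a,
      forall a b c, le a b -> le b c -> le a c
    & forall a b, exists2 c, le a c & le b c].

Definition net_tails (I : Type) (le : I -> I -> Prop) : set_system I :=
  filter_from setT (fun a => [set b | le a b]).

(* The library's [limf_esup] and [limf_einf] require a filtered type as domain,
   which an arbitrary directed set is not. *)
Definition net_limsup (R : realType) (I : Type) (le : I -> I -> Prop)
    (u : I -> \bar R) : \bar R :=
  ereal_inf [set ereal_sup [set u b | b in [set b | le a b]] | a in setT].

Definition net_liminf (R : realType) (I : Type) (le : I -> I -> Prop)
    (u : I -> \bar R) : \bar R :=
  ereal_sup [set ereal_inf [set u b | b in [set b | le a b]] | a in setT].

Notation borel X := (g_sigma_algebraType (@open X)).

Definition powmass (R : realType) (X : ptopologicalType) (I : Type)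
    (mu : I -> probability (borel X) R) (t : I -> R) (A : set X) (a : I) : \bar R :=
  mu a A `^ t a.

Definition powint (R : realType) (X : ptopologicalType) (I : Type)
    (mu : I -> probability (borel X) R) (t : I -> R) (h : X -> \bar R) (a : I) :
    \bar R :=
  (\int[mu a]_(x in setT) expeR (h x * ((t a)^-1)%:E)) `^ t a.

Definition upper_Lambda (R : realType) (X : ptopologicalType) (I : Type)
    (le : I -> I -> Prop) (mu : I -> probability (borel X) R) (t : I -> R)
    (h : X -> \bar R) : \bar R :=
  lne (net_limsup le (powint mu t h)).

Definition lower_Lambda (R : realType) (X : ptopologicalType) (I : Type)
    (le : I -> I -> Prop) (mu : I -> probability (borel X) R) (t : I -> R)
    (h : X -> \bar R) : \bar R :=
  lne (net_liminf le (powint mu t h)).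

(* Convergence takes place in the topology of \bar R, so an infinite limit is
   allowed. *)
Definition Lambda_exists (R : realType) (X : ptopologicalType) (I : Type)
    (le : I -> I -> Prop) (mu : I -> probability (borel X) R) (t : I -> R)
    (h : X -> \bar R) : Prop :=
  cvg (powint mu t h @ net_tails le).

(* Meaningful only under [Lambda_exists]. *)
Definition Lambda (R : realType) (X : ptopologicalType) (I : Type)
    (le : I -> I -> Prop) (mu : I -> probability (borel X) R) (t : I -> R)
    (h : X -> \bar R) : \bar R :=
  lne (lim (powint mu t h @ net_tails le)).

Definition trunc (R : realType) (X : Type) (h : X -> R) (M : R) (x : X) : \bar R :=
  if (h x < M)%R then (h x)%:E else -oo.

(* [maxe 0] because the supremum is taken in [0, 1], where the supremum of the
   empty set is 0, whereas [ereal_sup set0 = -oo]. *)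
Definition sup_exp (R : realType) (X : Type) (l : X -> \bar R) (A : set X) : \bar R :=
  maxe 0 (ereal_sup [set expeR (- l x) | x in A]).

Definition ldp_bounds (R : realType) (X : ptopologicalType) (I : Type)
    (le : I -> I -> Prop) (mu : I -> probability (borel X) R) (t : I -> R)
    (l : X -> \bar R) : Prop :=
  [/\ forall x, 0 <= l x,
      forall F, closed F -> net_limsup le (powmass mu t F) <= sup_exp l F
    & forall G, open G -> sup_exp l G <= net_liminf le (powmass mu t G)].

Definition is_lower_regularization (R : realType) (X : topologicalType)
    (l J : X -> \bar R) : Prop :=
  [/\ lower_semicontinuous J, forall x, J x <= l x
    & forall g : X -> \bar R, lower_semicontinuous g -> (forall x, g x <= l x) ->
        forall x, g x <= J x].

Definition ldp_with_rate (R : realType) (X : ptopologicalType) (I : Type)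
    (le : I -> I -> Prop) (mu : I -> probability (borel X) R) (t : I -> R)
    (J : X -> \bar R) : Prop :=
  exists2 l, ldp_bounds le mu t l & is_lower_regularization l J.

Definition l0 (R : realType) (X : ptopologicalType) (I : Type)
    (le : I -> I -> Prop) (mu : I -> probability (borel X) R) (t : I -> R)
    (x : X) : \bar R :=
  - lne (ereal_inf [set net_limsup le (powmass mu t G) |
                      G in [set G : set X | open G /\ G x]]).

Definition X0 (R : realType) (X : topologicalType) : set X :=
  [set x | forall (G : set X) (s t : R), open G -> G x -> (0 < s)%R -> (0 < t)%R ->
    exists h : X -> R, [/\ continuous h, bounded_fun h
      & forall y, (expR (- t) * \1_[set x] y <= expR (h y)
                   <= Num.max (\1_G y) (expR (- s)))%R]].
Arguments X0 R X : clear implicits.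

(* [S = setT] is exponential tightness, [S = X0 R X] is X_0-exponential
   tightness. *)
Definition exponentially_tight_in (R : realType) (X : ptopologicalType) (I : Type)
    (le : I -> I -> Prop) (mu : I -> probability (borel X) R) (t : I -> R)
    (S : set X) : Prop :=
  forall eps : R, (0 < eps)%R ->
    exists K : set X, [/\ compact K, K `<=` S
      & net_limsup le (powmass mu t (~` K)) < eps%:E].

Definition cover_condition (R : realType) (X : ptopologicalType) (I : Type)
    (le : I -> I -> Prop) (mu : I -> probability (borel X) R) (t : I -> R) : Prop :=
  forall (F : set X) (C : set (set X)) (eps : R),
    closed F -> C `<=` open -> F `&` X0 R X `<=` \bigcup_(G in C) G ->
    (0 < eps)%R ->
    exists D : set (set X), [/\ finite_set D, D `<=` C
      & net_limsup le (powmass mu t F)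
        - net_limsup le (powmass mu t (\bigcup_(G in D) closure G)) < eps%:E].

Definition function_algebra (R : realType) (X : Type) (A : set (X -> R)) : Prop :=
  [/\ A (fun=> 0%R),
      forall f g, A f -> A g -> A (fun x => f x + g x)%R,
      forall (c : R) f, A f -> A (fun x => c * f x)%R
    & forall f g, A f -> A g -> A (fun x => f x * g x)%R].

Definition separates_points (R : realType) (X : Type) (A : set (X -> R)) : Prop :=
  forall x y : X, x <> y -> exists2 h, A h & h x <> h y.

Definition nowhere_vanishing (R : realType) (X : Type) (A : set (X -> R)) : Prop :=
  forall x : X, exists2 h, A h & h x <> 0%R.

Definition well_separating (R : realType) (X : Type) (A : set (X -> R)) : Prop :=
  [/\ forall c : R, A (fun=> c),
      forall f g, A f -> A g -> A (fun x => Num.min (f x) (g x))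
    & forall (x y : X) (a b : R), x <> y -> exists g, [/\ A g, g x = a & g y = b]].

Definition bounded_above_part (R : realType) (X : Type) (A : set (X -> R)) :
    set (X -> R) :=
  [set h | A h /\ has_ubound (range h)].

Definition nonpositive_part (R : realType) (X : Type) (A : set (X -> R)) :
    set (X -> R) :=
  [set h | A h /\ forall x, (h x <= 0)%R].

(* The class [B] indexes the first supremum only.  In the last supremum,
   [lower_Lambda (trunc h M)] is nondecreasing in [M], so the limit exists. *)
Definition variational_formula (R : realType) (X : ptopologicalType) (I : Type)
    (le : I -> I -> Prop) (mu : I -> probability (borel X) R) (t : I -> R)
    (A B : set (X -> R)) (J : X -> \bar R) : Prop :=
  forall x, X0 R X x ->
    [/\ J x = ereal_sup [set (h x)%:E - Lambda le mu t (EFin \o h) | h in B],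
        J x = ereal_sup [set (h x)%:E - upper_Lambda le mu t (EFin \o h) | h in A],
        J x = ereal_sup [set (h x)%:E - lower_Lambda le mu t (EFin \o h) | h in A]
      & J x = ereal_sup [set (h x)%:E
                - lim (lower_Lambda le mu t (trunc h M) @[M --> +oo%R]) | h in A]].

Definition ldp_conclusion (R : realType) (X : ptopologicalType) (I : Type)
    (le : I -> I -> Prop) (mu : I -> probability (borel X) R) (t : I -> R)
    (A B : set (X -> R)) : Prop :=
  exists J : X -> \bar R,
    [/\ ldp_with_rate le mu t J,
        forall x, ~ closure (X0 R X) x -> J x = +oo,
        variational_formula le mu t A B J
      & regular_space X ->
          (forall x, J x = ereal_sup [set ereal_inf (J @` (G `&` X0 R X)) |
                                        G in [set G : set X | open G /\ G x]])
          /\ forall J', ldp_with_rate le mu t J' -> forall x, J' x = J x].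

(* Main.v *)
(** The rate function is [J x = sup_{h in B} (h x - Lambda h)] at every point
    [x] of [X], where [B] is the class of functions of [A] on which [Lambda]
    exists.

    Upper bound: Chebyshev's inequality applied to [h] in [B] on a set
    [{h > h x - e}] gives an open neighborhood of [x] of mass at most about
    [e^(- J x)]; compactness and exponential tightness extend this to closed sets.

    Lower bound: for every [x], every compact [K] not containing [x] and every
    [c], there is [h] in [B] with maximum [h x] and [h <= h x - c] on [K].  For an
    algebra it is a sum of functions [- N u^2 + 2 N u(x) u], whose defect at [y]
    is [N (u x - u y)^2]; hence no constants and no Stone-Weierstrass argument
    are needed.  Testing [Lambda h] on such an [h] forces an open set containing
    [x] to have mass at least [e^(- J x)].

    Conditions (i)-(iii) are used only to show that [J] is infinite outside the
    closure of [X0] and to compute [J] from its restriction to [X0]. *)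

Require Import Defs.
From HB Require Import structures.
From mathcomp Require Import all_boot all_order all_algebra finmap.
From mathcomp Require Import all_classical all_reals all_analysis measurable_realfun.
From mathcomp Require Import ring lra.

Set Implicit Arguments.
Unset Strict Implicit.
Unset Printing Implicit Defensive.

Import Order.TTheory GRing.Theory Num.Theory.
Import numFieldNormedType.Exports.

Local Open Scope classical_set_scope.
Local Open Scope ring_scope.
Local Open Scope ereal_scope.

(** * Extended reals tested against values of the real exponential *)

Section ereal_exp.
Context (R : realType).
Implicit Types (x y : \bar R) (m : \bar R) (s c : R).

(** Masses are compared at levels [expR c], because a bound [expR c] on a power [t a] is the bound
    [expR (c / t a)] on its base. *)
Lemma exists_expR_between x y : 0 <= x -> x < y ->
  exists c, x < (expR c)%:E /\ (expR c)%:E < y.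
Proof.
case: x => [r||] //; rewrite ?lee_fin => r0; last first.
  by rewrite ltNge leey.
case: y => [s||] //; rewrite ?lte_fin.
- by move=> rs; exists (ln ((r + s) / 2)%R); rewrite lnK ?posrE ?lte_fin; lra.
- by move=> _; exists (ln (r + 1)%R); rewrite lnK ?posrE ?ltry ?lte_fin; lra.
Qed.

Lemma le_from_expR x y : 0 <= y ->
  (forall c, y < (expR c)%:E -> x <= (expR c)%:E) -> x <= y.
Proof.
move=> y0 H; rewrite leNgt; apply/negP => /(exists_expR_between y0)[c [yc cx]].
by have := H c yc; rewrite leNgt cx.
Qed.

(** For [x <= 0] both sides hold, [lne x] being -oo. *)
Lemma lne_le x c : (lne x <= c%:E) = (x <= (expR c)%:E).
Proof.
have -> : (expR c)%:E = expeR c%:E by [].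
have [x0|x0] := leP x 0; last first.
  by rewrite -lee_expeR lneK// in_itv/= (ltW x0) leey.
by rewrite le0_lneNy// leNye (le_trans x0)// expeR_ge0.
Qed.

Lemma lne_lt x c : (lne x < c%:E) = (x < (expR c)%:E).
Proof.
have -> : (expR c)%:E = expeR c%:E by [].
have [x0|x0] := leP x 0; last first.
  by rewrite -lte_expeR lneK// in_itv/= (ltW x0) leey.
by rewrite le0_lneNy// ltNyr (le_lt_trans x0)//= lte_fin expR_gt0.
Qed.

Lemma le_lne x c : (c%:E <= lne x) = ((expR c)%:E <= x).
Proof. by rewrite !leNgt lne_lt. Qed.

Lemma le_lne_mono x y : x <= y -> lne x <= lne y.
Proof.
move=> xy; have [x0|x0] := leP x 0; first by rewrite (le0_lneNy x0) leNye.
by rewrite lee_lne// in_itv/= leey ?(ltW x0) // (ltW (lt_le_trans x0 xy)).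
Qed.

Lemma poweR_lt_expR m s c : 0 <= m -> (0 < s)%R ->
  (m `^ s < (expR c)%:E) = (m < (expR (c / s))%:E).
Proof.
move=> m0 s0; have s1 : (s != 0)%R by rewrite gt_eqF.
have E : expR c = (expR (c / s) `^ s)%R by rewrite -expRM divfK.
case: m m0 => [r||] //; rewrite ?lee_fin => r0.
  by rewrite poweR_EFin !lte_fin E (leW_mono_in (le_mono_in (gt0_ltr_powR s0)))//
    ?nnegrE ?expR_ge0.
by rewrite poweRyr// !ltNge !leey.
Qed.

Lemma poweR_le_expR m s c : 0 <= m -> (0 < s)%R ->
  (m `^ s <= (expR c)%:E) = (m <= (expR (c / s))%:E).
Proof.
move=> m0 s0; have s1 : (s != 0)%R by rewrite gt_eqF.
have E : expR c = (expR (c / s) `^ s)%R by rewrite -expRM divfK.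
case: m m0 => [r||] //; rewrite ?lee_fin => r0.
  by rewrite ?poweR_EFin ?lee_fin E (le_mono_in (gt0_ltr_powR s0))//
    ?nnegrE ?expR_ge0.
by rewrite poweRyr// !leNgt !ltry.
Qed.

Lemma lt_fin_sub c s y : (c%:E < s%:E - y) = (c%:E + y < s%:E).
Proof.
case: y => [r||] /=; last by rewrite ltNyr ltry.
  by rewrite -?EFinN -?EFinD ?lte_fin ltrBrDr.
by rewrite [LHS]ltNge [RHS]ltNge leNye leey.
Qed.

End ereal_exp.

(** * Upper and lower limits along a net *)

Section nets.
Context (R : realType) (I : Type) (le : I -> I -> Prop).
Context (le_directed : directed_set le).
Implicit Types u v : I -> \bar R.

Lemma net_tails_proper : ProperFilter (net_tails le).
Proof.
case: le_directed => -[i0] rfl tr dir; apply: filter_from_proper.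
  apply: filter_from_filter; first by exists i0.
  move=> i j _ _; have [k ik jk] := dir i j; exists k => // b /= kb.
  by split; [exact: tr ik kb|exact: tr jk kb].
by move=> i _; exists i; exact: rfl.
Qed.

Lemma net_limsup_lt u c : net_limsup le u < c ->
  \forall a \near net_tails le, u a < c.
Proof.
move=> /ereal_inf_lt[_ [a _ <-] sc]; exists a => // b ab /=.
by apply: le_lt_trans sc; apply: ereal_sup_ubound; exists b.
Qed.

Lemma net_limsup_le u c : (\forall a \near net_tails le, u a <= c) ->
  net_limsup le u <= c.
Proof.
move=> [a _ uc]; apply: ereal_inf_le; eexists; first by exists a.
by apply: ge_ereal_sup => _ [b ab <-]; exact: uc.
Qed.

Lemma net_liminf_gt u c : c < net_liminf le u ->
  \forall a \near net_tails le, c < u a.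
Proof.
move=> /ereal_sup_gt[_ [a _ <-] sc]; exists a => // b ab /=.
by apply: lt_le_trans sc _; apply: ereal_inf_lbound; exists b.
Qed.

Lemma net_liminf_ge u c : (\forall a \near net_tails le, c <= u a) ->
  c <= net_liminf le u.
Proof.
move=> [a _ uc]; apply: ereal_sup_ge; eexists; first by exists a.
by apply: le_ereal_inf_tmp => _ [b ab <-]; exact: uc.
Qed.

Lemma net_liminf_le_limsup u : net_liminf le u <= net_limsup le u.
Proof.
case: le_directed => _ _ _ dir.
apply: ge_ereal_sup => _ [a _ <-]; apply: le_ereal_inf_tmp => _ [b _ <-].
have [c ac bc] := dir a b; apply: (@le_trans _ _ (u c)).
  by apply: ereal_inf_lbound; exists c.
by apply: ereal_sup_ubound; exists c.
Qed.

Lemma net_liminf_ge0 u : (forall a, 0 <= u a) -> 0 <= net_liminf le u.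
Proof.
move=> u0; apply: net_liminf_ge.
by have FF := net_tails_proper; apply: nearW.
Qed.

Lemma le_net_liminf u v : (forall a, u a <= v a) ->
  net_liminf le u <= net_liminf le v.
Proof.
move=> uv; apply: ge_ereal_sup => _ [a _ <-]; apply: net_liminf_ge.
exists a => // b /= ab; apply: le_trans (uv b).
by apply: ereal_inf_lbound; exists b.
Qed.

Lemma le_net_limsup u v : (forall a, u a <= v a) ->
  net_limsup le u <= net_limsup le v.
Proof.
move=> uv; apply: le_ereal_inf_tmp => _ [a _ <-]; apply: net_limsup_le.
exists a => // b /= ab; apply: le_trans (uv b) _.
by apply: ereal_sup_ubound; exists b.
Qed.

Lemma net_cvg_lim u : (forall a, 0 <= u a) -> cvg (u @ net_tails le) ->
  net_limsup le u = lim (u @ net_tails le) /\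
  net_liminf le u = lim (u @ net_tails le).
Proof.
have FF := net_tails_proper.
move=> u0 cu; set l := lim _.
have uleqs : net_limsup le u <= l.
  apply: le_from_expR => [|c lc].
    by apply: lime_ge => //; exact: nearW.
  apply: net_limsup_le; apply: (filterS (P := [set a | u a < (expR c)%:E])).
    by move=> a /ltW.
  exact: (cu _ (open_nbhs_nbhs (conj (@open_ereal_lt_ereal R _) lc))).
have leui : l <= net_liminf le u.
  rewrite leNgt; apply/negP => /(exists_expR_between (net_liminf_ge0 u0))[c].
  move=> [ic cl]; suff: (expR c)%:E <= net_liminf le u by rewrite leNgt ic.
  apply: net_liminf_ge; apply: (filterS (P := [set a | (expR c)%:E < u a])).
    by move=> a /ltW.
  exact: (cu _ (open_nbhs_nbhs (conj (@open_ereal_gt_ereal R _) cl))).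
have il := net_liminf_le_limsup u.
split; apply/eqP; rewrite eq_le.
  by rewrite uleqs (le_trans leui).
by rewrite leui (le_trans il).
Qed.

End nets.

(** * Finite unions, compact covers and lower semicontinuity *)

Lemma finite_bigcup_ind (X : Type) (U : choiceType) (P : set X -> Prop)
    (D : set U) (f : U -> set X) :
  finite_set D -> P set0 -> (forall S T, P S -> P T -> P (S `|` T)) ->
  (forall i, D i -> P (f i)) -> P (\bigcup_(i in D) f i).
Proof.
move=> /finite_seqP[s ->] P0 PU Pf; rewrite bigcup_seq big_seq.
by apply: big_ind => // i si; exact: Pf.
Qed.

(** Compactness as an induction principle, applied with [P] a bound on the mass or a uniform drop of
    a peaking function. *)
Lemma compact_open_ind (X : ptopologicalType) (K : set X) (P : set X -> Prop) :
  compact K -> P set0 -> (forall S T, P S -> P T -> P (S `|` T)) ->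
  (forall x, K x -> exists G, [/\ open G, G x & P G]) ->
  exists2 G, K `<=` G & P G.
Proof.
rewrite compact_cover => cK P0 PU Ploc.
have /choice[f Hf] x : exists G, K x -> [/\ open G, G x & P G].
  have [/Ploc[G HG]|Kx] := pselect (K x); first by exists G.
  by exists set0.
have [|x Kx|D' DK KD'] := cK X K f; first by move=> x /Hf[].
  by exists x => //; have [] := Hf x Kx.
exists (cover [set` D'] f) => //; apply: finite_bigcup_ind => // x D'x.
by have /set_mem/Hf[] := DK _ D'x.
Qed.

Lemma lsc_open (R : realType) (X : topologicalType) (f : X -> \bar R) c :
  lower_semicontinuous f -> open [set x | c%:E < f x].
Proof. by move/lower_semicontinuousP. Qed.

Lemma continuous_lsc (R : realType) (X : topologicalType) (h : X -> R) :
  continuous h -> lower_semicontinuous (EFin \o h).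
Proof.
move=> ch; apply/lower_semicontinuousP => c.
have -> : [set x | c%:E < (EFin \o h) x] = h @^-1` [set y | (c < y)%R].
  by apply/seteqP; split => x /=; rewrite lte_fin.
by apply: open_comp => // x _; exact: ch.
Qed.

(** Lower semicontinuity allows a drop to -oo on the closed set where [h >= M]. *)
Lemma trunc_lsc (R : realType) (X : topologicalType) (h : X -> R) M :
  continuous h -> lower_semicontinuous (trunc h M).
Proof.
move=> ch; apply/lower_semicontinuousP => c.
have -> : [set x | c%:E < trunc h M x] =
    h @^-1` [set y | (c < y)%R] `&` h @^-1` [set y | (y < M)%R].
  apply/seteqP; split => x /=; rewrite /trunc; case: ifPn => hM.
  - by rewrite lte_fin.
  - by rewrite ltNge leNye.
  - by rewrite lte_fin => -[].
  - by case.
by apply: openI; apply: open_comp => // x _; exact: ch.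
Qed.

(** * Borel integrals of exponentials of lower semicontinuous functions *)

Section borel_integrals.
Context (R : realType) (X : ptopologicalType).
Implicit Types (f : X -> \bar R) (S G : set X) (P : probability (borel X) R).

Lemma open_borel G : open G -> measurable (G : set (borel X)).
Proof. by move=> oG; exact: sub_sigma_algebra. Qed.

Lemma closed_borel F : closed F -> measurable (F : set (borel X)).
Proof.
move=> cF; rewrite -[F]setCK; apply: measurableC; apply: open_borel.
exact: closed_openC.
Qed.

Lemma measurable_expeR_lsc f s : (0 < s)%R -> lower_semicontinuous f ->
  @measurable_fun _ _ (borel X) _ setT (fun x => expeR (f x * s%:E)).
Proof.
move=> s0 lf.
apply: (measurability _ (ErealGenOInfty.measurableE R)).
move=> /= _ [_ [a ->]] <-; apply: measurableI => //; rewrite preimage_itvoy.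
have [a0|a0] := ltP a 0%R.
  rewrite (_ : [set _ | _] = setT)//; apply/seteqP; split => x //= _.
  by rewrite (lt_le_trans _ (expeR_ge0 _)).
have fsE c x : (c%:E < f x * s%:E) = ((c / s)%:E < f x).
  by rewrite EFinM lte_pdivrMr.
(* At level 0: the exponential is positive exactly where [f] is not -oo, a countable union of
   superlevel sets. *)
move: a0; rewrite le_eqVlt => /predU1P[<-|a0].
  rewrite (_ : [set _ | _] = \bigcup_n [set x | (- n%:R)%:E < f x]).
    by apply: bigcup_measurable => n _; apply: open_borel; exact: lsc_open.
  apply/seteqP; split => x /=.
    have [|fx _] := eqVneq (f x) -oo.
      by move=> ->; rewrite gt0_mulNye ?lte_fin//= ltxx.
    have [n nf] : exists n : nat, (- n%:R)%:E < f x.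
      move: fx; case: (f x) => [r||] // _; last by exists 0%N; rewrite ltry.
      exists (Num.bound `|r|%R); rewrite lte_fin ltrNl.
      by apply: le_lt_trans (archi_boundP (normr_ge0 r)); rewrite -normrN ler_norm.
    by exists n.
  move=> [n _] /= nf; apply: expeR_gt0.
  by apply: lt_trans (ltNyr (- n%:R * s)) _; rewrite fsE mulfK// gt_eqF.
rewrite (_ : [set _ | _] = [set x | (ln a / s)%:E < f x]).
  by apply: open_borel; exact: lsc_open.
have aE : a%:E = expeR (ln a)%:E by rewrite /= lnK.
by apply/seteqP; split => x /=; rewrite aE lte_expeR fsE.
Qed.

Lemma le_lsc_integral P f g s : (0 < s)%R ->
    lower_semicontinuous f -> lower_semicontinuous g -> (forall x, f x <= g x) ->
  \int[P]_(x in setT) expeR (f x * s%:E) <= \int[P]_(x in setT) expeR (g x * s%:E).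
Proof.
move=> s0 lf lg fg; apply: ge0_le_integral => //.
- by move=> x _; exact: expeR_ge0.
- exact: measurable_expeR_lsc.
- exact: measurable_expeR_lsc.
- by move=> x _; rewrite lee_expeR lee_wpmul2r// lee_fin ltW.
Qed.

(** Chebyshev's inequality on the open set [G]. *)
Lemma lsc_integral_ge P f s G b : (0 < s)%R -> lower_semicontinuous f ->
    open G -> (forall x, G x -> b%:E <= f x) ->
  (expR (b * s))%:E * P G <= \int[P]_(x in setT) expeR (f x * s%:E).
Proof.
move=> s0 lf oG fG; have mG := open_borel oG.
rewrite -integral_cst//.
have mf := measurable_expeR_lsc s0 lf.
apply: (@le_trans _ _ (\int[P]_(x in G) expeR (f x * s%:E))); last first.
  by apply: ge0_subset_integral => // x _; exact: expeR_ge0.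
apply: ge0_le_integral => //.
- by move=> x _; rewrite lee_fin expR_ge0.
- exact: measurable_funTS.
- move=> x Gx; rewrite /cst -[(expR _)%:E]/(expeR _%:E) lee_expeR EFinM.
  by rewrite lee_wpmul2r// ?lee_fin ?(ltW s0)// fG.
Qed.

(** The integral is split at [S]; the mass outside [S] is bounded by 1. *)
Lemma lsc_integral_le P f s S b b' : (0 < s)%R -> lower_semicontinuous f ->
    measurable (S : set (borel X)) ->
    (forall x, f x <= b%:E) -> (forall x, ~ S x -> f x <= b'%:E) ->
  \int[P]_(x in setT) expeR (f x * s%:E) <=
    (expR (b * s))%:E * P S + (expR (b' * s))%:E.
Proof.
move=> s0 lf mS fb fb'; have mf := measurable_expeR_lsc s0 lf.
have mSc : measurable (~` S : set (borel X)) by exact: measurableC.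
have bnd c (T : set X) : measurable (T : set (borel X)) ->
    (forall x, T x -> f x <= c%:E) ->
    \int[P]_(x in T) expeR (f x * s%:E) <= (expR (c * s))%:E * P T.
  move=> mT fc; rewrite -integral_cst//; apply: ge0_le_integral => //.
  - by move=> x _; exact: expeR_ge0.
  - exact: measurable_funTS.
  - move=> x Tx; rewrite /cst -[(expR _)%:E]/(expeR _%:E) lee_expeR EFinM.
    by rewrite lee_wpmul2r// ?lee_fin ?(ltW s0)// fc.
rewrite -(setUv S) ge0_integral_setU//=.
- apply: leeD; first by apply: bnd => // x _.
  apply: le_trans (bnd _ _ mSc fb') _.
  rewrite -[leRHS]mule1; apply: lee_wpmul2l; last exact: probability_le1.
  by rewrite lee_fin expR_ge0.
- by rewrite setUv.
- by move=> x _; exact: expeR_ge0.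
- by apply/disj_setPS => x [].
Qed.

End borel_integrals.

(** * Functions peaking at a point *)

Definition peaking (R : realType) (X : Type) (B : set (X -> R)) (x : X) :
    set (X -> R) :=
  [set h | B h /\ forall y, (h y <= h x)%R].

(* [P x] may be smaller than [peaking B x]: in a well-separating class, which
   need not be stable under translations by constants, the last clause requires
   the value at [x] to be fixed. *)
Definition peak_class (R : realType) (X : Type) (B : set (X -> R)) : Prop :=
  exists P : X -> set (X -> R), forall x,
  [/\ P x `<=` peaking B x,
      P x (fun=> 0%R),
      forall y (c : R), x <> y -> exists2 h, P x h & (h y <= h x - c)%R
    & forall h1 h2, P x h1 -> P x h2 -> exists2 h, P x h &
        forall y, (h y - h x <= h1 y - h1 x)%R /\ (h y - h x <= h2 y - h2 x)%R].

Lemma peak_compact (R : realType) (X : ptopologicalType) (B : set (X -> R))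
    (x : X) (K : set X) (c : R) :
  peak_class B -> (forall h, B h -> continuous h) -> compact K -> ~ K x ->
  exists2 h, peaking B x h & forall y, K y -> (h y <= h x - c)%R.
Proof.
move=> [P /(_ x)[PB P0 Psep Pcomb]] Bc cK Kx.
pose Q S := exists2 h, P x h & forall y, S y -> (h y <= h x - c)%R.
suff [G KG [h Ph hG]] : exists2 G, K `<=` G & Q G.
  by exists h; [exact: PB|move=> y /KG/hG].
apply: compact_open_ind => //.
- by exists (fun=> 0%R).
- move=> S T [h1 p1 h1S] [h2 p2 h2T]; have [h p hh] := Pcomb _ _ p1 p2.
  exists h => // y; have [y1 y2] := hh y.
  by case=> [/h1S|/h2T]; lra.
(* The extra 1 makes the drop at [y] strict, so that it persists on an open neighborhood. *)
- move=> y Ky; have [|h p hy] := Psep y (c + 1)%R.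
    by move=> xy; apply: Kx; rewrite xy.
  exists (h @^-1` [set z | (z < h x - c)%R]); split => /=.
  + by apply: open_comp => // z _; apply: Bc; case: (PB _ p).
  + by lra.
  + by exists h => // z /= /ltW.
Qed.

(** The level [h x - 1/2] of a function peaking at [x] and dropping by 1 at [y] separates the two
    points. Compact sets are then closed. *)
Lemma peak_hausdorff (R : realType) (X : topologicalType) (B : set (X -> R)) :
  peak_class B -> (forall h, B h -> continuous h) -> hausdorff_space X.
Proof.
move=> [P HP] Bc; rewrite open_hausdorff => x y /eqP xy.
have [PB _ Psep _] := HP x.
have [h /PB[/Bc hc _] hy] := Psep y 1%R xy.
exists (h @^-1` [set z | (h x - 1 / 2 < z)%R],
        h @^-1` [set z | (z < h x - 1 / 2)%R]).
  by split; rewrite inE /=; lra.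
split => /=; first by apply: open_comp => // z _; exact: hc.
  by apply: open_comp => // z _; exact: hc.
by apply/eqP; rewrite -subset0 => z /= [] /lt_trans/[apply]; rewrite ltxx.
Qed.

(** A Legendre-Fenchel transform of [Lambda], with the functions of [B] in the role of linear
    forms. *)
Definition rate (R : realType) (X : ptopologicalType) (I : Type)
    (le : I -> I -> Prop) (mu : I -> probability (borel X) R) (t : I -> R)
    (B : set (X -> R)) (x : X) : \bar R :=
  ereal_sup [set (h x)%:E - Lambda le mu t (EFin \o h) | h in B].

(** * Masses and exponential integrals at the scale [t] *)

Section large_deviations.
Context (R : realType) (X : ptopologicalType) (I : Type) (le : I -> I -> Prop)
  (mu : I -> probability (borel X) R) (t : I -> R).
Context (le_directed : directed_set le).
Context (t_gt0 : forall a, (0 < t a)%R).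
Context (t_cvg0 : t @ net_tails le --> (0 : R)%R).
Implicit Types (f : X -> \bar R) (h : X -> R) (F G S T K : set X) (c d r : R).

Local Notation massL S := (net_limsup le (powmass mu t S)).
Local Notation massl S := (net_liminf le (powmass mu t S)).

Let net_filter : ProperFilter (net_tails le) := net_tails_proper le_directed.
Local Existing Instance net_filter.

Let tV_gt0 a : (0 < (t a)^-1)%R. Proof. by rewrite invr_gt0. Qed.

(** Constant factors disappear at the scale [t]: [expR ((d - c) / t a)] exceeds [n] once [t a] is
    small. *)
Lemma scale_near n c d : (c < d)%R -> \forall a \near net_tails le,
  (n%:R * expR (c / t a) <= expR (d / t a))%R.
Proof.
move=> cd; have dc0 : (0 < d - c)%R by rewrite subr_gt0.
have n1 : (0 < n.+1%:R :> R)%R by rewrite ltr0n.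
(* This gives [(d - c) / t a > n + 1], to be used with [expR z >= 1 + z]; [n.+1] keeps the divisor
   positive. *)
have : \forall a \near net_tails le, (t a < (d - c) / n.+1%:R)%R.
  by apply: (cvgr_lt _ t_cvg0); rewrite divr_gt0.
apply: filterS => a ta.
rewrite -[in leRHS](subrK c d) mulrDl expRD ler_wpM2r ?expR_ge0//.
apply: le_trans (expR_ge1Dx _).
have : (n.+1%:R < (d - c) / t a)%R by rewrite ltr_pdivlMr// mulrC -ltr_pdivlMr.
by rewrite -natr1; lra.
Qed.

Lemma powmass_ge0 S a : 0 <= powmass mu t S a.
Proof. exact: poweR_ge0. Qed.

Lemma powint_ge0 f a : 0 <= powint mu t f a.
Proof. exact: poweR_ge0. Qed.

Lemma massL_ge0 S : 0 <= massL S.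
Proof.
apply: le_trans (net_liminf_le_limsup le_directed _).
by apply: net_liminf_ge0 => // a; exact: powmass_ge0.
Qed.

Lemma massl_ge0 S : 0 <= massl S.
Proof. by apply: net_liminf_ge0 => // a; exact: powmass_ge0. Qed.

Lemma powmass_le_expR S c a :
  (powmass mu t S a <= (expR c)%:E) = (mu a S <= (expR (c / t a))%:E).
Proof. exact: poweR_le_expR. Qed.

Lemma powmass_lt_expR S c a :
  (powmass mu t S a < (expR c)%:E) = (mu a S < (expR (c / t a))%:E).
Proof. exact: poweR_lt_expR. Qed.

Lemma powint_le_expR f c a : (powint mu t f a <= (expR c)%:E) =
  (\int[mu a]_(x in setT) expeR (f x * ((t a)^-1)%:E) <= (expR (c / t a))%:E).
Proof.
by apply: poweR_le_expR => //; apply: integral_ge0 => x _; exact: expeR_ge0.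
Qed.

Lemma powmass_le S T a : measurable (S : set (borel X)) ->
  measurable (T : set (borel X)) -> S `<=` T -> powmass mu t S a <= powmass mu t T a.
Proof.
move=> mS mT ST; apply: gt0_ler_poweR;
  rewrite ?in_itv/= ?leey ?measure_ge0 ?(ltW (t_gt0 a))//.
by apply: le_measure; rewrite ?inE.
Qed.

Lemma massL_mono S T : measurable (S : set (borel X)) ->
  measurable (T : set (borel X)) -> S `<=` T -> massL S <= massL T.
Proof. by move=> mS mT ST; apply: le_net_limsup => a; exact: powmass_le. Qed.

Lemma massL_set0 : massL set0 = 0.
Proof.
apply/eqP; rewrite eq_le massL_ge0 andbT; apply: net_limsup_le.
by apply: nearW => a; rewrite /powmass measure0 poweR0r// gt_eqF.
Qed.

(** Two masses below [expR (c / t a)] add up to at most twice that, and raising [c] to [d] absorbs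
    the factor 2. *)
Lemma massL_setU_lt S T (y : \bar R) : measurable (S : set (borel X)) ->
    measurable (T : set (borel X)) ->
  massL S < y -> massL T < y -> massL (S `|` T) < y.
Proof.
move=> mS mT Sy Ty.
have : maxe (massL S) (massL T) < y by rewrite gt_max Sy.
move=> /exists_expR_between[|c []]; first by rewrite le_max massL_ge0.
rewrite gt_max => /andP[Sc Tc] cy.
have [|d [cd dy]] := exists_expR_between _ cy; first by rewrite lee_fin expR_ge0.
apply: le_lt_trans dy; apply: net_limsup_le.
rewrite lte_fin ltr_expR in cd.
apply: filterS3 (net_limsup_lt Sc) (net_limsup_lt Tc) (scale_near 2 cd) => a.
rewrite !powmass_lt_expR powmass_le_expR => Sa Ta ca.
apply: le_trans (measureU2 _ mS mT) _.
apply: (@le_trans _ _ ((2 * expR (c / t a))%:E)); last by rewrite lee_fin.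
by rewrite mulr_natl mulr2n EFinD; apply: leeD; exact: ltW.
Qed.

Lemma powint_ge f G b a : lower_semicontinuous f -> open G ->
    (forall x, G x -> b%:E <= f x) ->
  (expR b)%:E * powmass mu t G a <= powint mu t f a.
Proof.
move=> lf oG fG.
have := lsc_integral_ge (mu a) (tV_gt0 a) lf oG fG.
have -> : (expR b)%:E = (expR (b / t a))%:E `^ t a.
  by rewrite poweR_EFin -expRM divfK// gt_eqF.
rewrite -poweRM ?lee_fin ?expR_ge0 ?measure_ge0// => le_int.
apply: gt0_ler_poweR => //; rewrite ?in_itv/= ?leey ?andbT ?(ltW (t_gt0 a))//.
- by rewrite mule_ge0 ?lee_fin ?expR_ge0 ?measure_ge0.
- by apply: integral_ge0 => x _; exact: expeR_ge0.
Qed.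

Lemma powint_mono f g a : lower_semicontinuous f -> lower_semicontinuous g ->
  (forall x, f x <= g x) -> powint mu t f a <= powint mu t g a.
Proof.
move=> lf lg fg; apply: gt0_ler_poweR; rewrite ?(ltW (t_gt0 a))//.
- by rewrite in_itv/= leey andbT integral_ge0// => x _; exact: expeR_ge0.
- by rewrite in_itv/= leey andbT integral_ge0// => x _; exact: expeR_ge0.
- exact: le_lsc_integral.
Qed.

Lemma lower_Lambda_mono f g :
  lower_semicontinuous f -> lower_semicontinuous g -> (forall x, f x <= g x) ->
  lower_Lambda le mu t f <= lower_Lambda le mu t g.
Proof.
move=> lf lg fg; apply: le_lne_mono; apply: le_net_liminf => a.
exact: powint_mono.
Qed.

Lemma lower_le_upper_Lambda f : lower_Lambda le mu t f <= upper_Lambda le mu t f.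
Proof. by apply: le_lne_mono; exact: net_liminf_le_limsup. Qed.

Lemma Lambda_upper f : Lambda_exists le mu t f ->
  upper_Lambda le mu t f = Lambda le mu t f.
Proof.
move=> /(net_cvg_lim le_directed (powint_ge0 f))[].
by rewrite /upper_Lambda /Lambda => ->.
Qed.

Lemma Lambda_lower f : Lambda_exists le mu t f ->
  lower_Lambda le mu t f = Lambda le mu t f.
Proof.
move=> /(net_cvg_lim le_directed (powint_ge0 f))[].
by rewrite /lower_Lambda /Lambda => _ ->.
Qed.

(** * The large deviation principle for the rate of a peak class *)

Context (B : set (X -> R)).
Context (B_cont : forall h, B h -> continuous h).
Context (B_Lambda : forall h, B h -> Lambda_exists le mu t (EFin \o h)).
Context (B_peak : peak_class B).
Context (tight : exponentially_tight_in le mu t setT).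

Local Notation J := (rate le mu t B).

Let X_hausdorff : hausdorff_space X := peak_hausdorff B_peak B_cont.

Lemma tight_expR c : exists2 K : set X, compact K & massL (~` K) < (expR c)%:E.
Proof. by have [K [cK _ LK]] := tight (expR_gt0 c); exists K. Qed.

Lemma compl_compact_borel K : compact K -> measurable (~` K : set (borel X)).
Proof.
by move=> cK; apply: measurableC; apply: closed_borel; exact: compact_closed.
Qed.

(** The zero function lies in [B], and its exponential has integral at most 1. *)
Lemma rate_ge0 x : 0 <= J x.
Proof.
have B0 : B (fun=> 0%R) by have [P /(_ x)[PB /PB[]]] := B_peak.
apply: ereal_sup_ge; eexists; first by exists (fun=> 0%R).
rewrite -(Lambda_upper (B_Lambda B0)) /= add0e oppe_ge0 lne_le.
apply: net_limsup_le; apply: nearW => a; rewrite powint_le_expR mul0r.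
rewrite (eq_integral (cst 1)) => [|z _]; last by rewrite /= mul0r expR0.
by rewrite integral_cst// mul1e expR0 probability_le1.
Qed.

Lemma rate_lsc : lower_semicontinuous J.
Proof.
apply/lower_semicontinuousP => c.
(* With [Lambda] moved to the left, each set is a superlevel set of a continuous [h], or empty or
   full when [Lambda] is infinite. *)
rewrite (_ : [set x | _] = \bigcup_(h in B)
    [set x | c%:E + Lambda le mu t (EFin \o h) < (h x)%:E]).
  apply: bigcup_open => h Bh; case: (Lambda le mu t (EFin \o h)) => [r||] /=.
  - rewrite (_ : [set _ | _] = h @^-1` [set z | (c + r < z)%R]).
      by apply: open_comp => // z _; exact: B_cont.
    by apply/seteqP; split => z /=; rewrite lte_fin.
  - rewrite (_ : [set _ | _] = set0); first exact: open0.
    by apply/seteqP; split => z.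
  - rewrite (_ : [set _ | _] = setT); first exact: openT.
    by apply/seteqP; split => z //= _; rewrite ltNyr.
apply/seteqP; split => x /=.
  by move=> /ereal_sup_gt[_ [h Bh <-]]; rewrite lt_fin_sub; exists h.
move=> [h Bh /=]; rewrite -lt_fin_sub => hx; apply: lt_le_trans hx _.
by apply: ereal_sup_ubound; exists h.
Qed.

Lemma rate_local x c : expeR (- J x) < (expR c)%:E ->
  exists G, [/\ open G, G x & massL G < (expR c)%:E].
Proof.
rewrite -[(expR c)%:E]/(expeR c%:E) lte_expeR lteNl.
move=> /ereal_sup_gt[_ [h Bh <-]].
rewrite -(Lambda_upper (B_Lambda Bh)) => hc.
have : upper_Lambda le mu t (EFin \o h) < (h x + c)%:E.
  move: hc; rewrite -EFinN lt_fin_sub.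
  case: (upper_Lambda _ _ _ _) => [r||] //.
  - by rewrite -EFinD !lte_fin; lra.
  - by move=> _; rewrite ltNyr.
rewrite lne_lt => /exists_expR_between[].
  apply: le_trans (net_liminf_le_limsup le_directed _).
  by apply: net_liminf_ge0 => // a; exact: powint_ge0.
move=> d [Ld]; rewrite lte_fin ltr_expR => dh.
(* Half the margin: [(h x - e) + (c - e) = d], so Chebyshev at level [h x - e] leaves mass at most
   [expR (c - e)]. *)
pose e := ((h x + c - d) / 2)%R.
have hc' : continuous h := B_cont Bh.
have oG : open (h @^-1` [set z | (h x - e < z)%R]).
  by apply: open_comp => // z _; exact: hc'.
exists (h @^-1` [set z | (h x - e < z)%R]); split => //=.
  by rewrite /e; lra.
apply: (@le_lt_trans _ _ (expR (c - e))%:E); last first.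
  by rewrite lte_fin ltr_expR /e; lra.
apply: net_limsup_le; apply: filterS (net_limsup_lt Ld) => a ad.
have := @powint_ge (EFin \o h) _ (h x - e)%R a (continuous_lsc hc') oG.
move=> /(_ (fun x Gx => ltW Gx)) /le_lt_trans /(_ ad).
have -> : expR d = (expR (h x - e) * expR (c - e))%R.
  by rewrite -expRD; congr expR; rewrite /e; lra.
by rewrite EFinM lte_pmul2l// ?lte_fin ?expR_gt0// => /ltW.
Qed.

(** Finitely many neighborhoods from [rate_local] cover the part of [F] in a compact [K]; the rest
    of [F] lies outside [K]. *)
Lemma rate_upper F : closed F -> massL F <= sup_exp J F.
Proof.
move=> cF; apply: le_from_expR => [|c]; first by rewrite le_max lexx.
rewrite gt_max => /andP[_ Fc].
have [K cK LK] := tight_expR c.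
have cKF : compact (K `&` F) by exact: compact_closedI.
have [|||G KFG [oG LG]] :=
  @compact_open_ind X (K `&` F) (fun S => open S /\ massL S < (expR c)%:E) cKF.
- by split; [exact: open0|rewrite massL_set0 lte_fin expR_gt0].
- move=> S T [oS LS] [oT LT]; split; first exact: openU.
  by apply: massL_setU_lt => //; exact: open_borel.
- move=> x [_ Fx]; have [|G [oG Gx LG]] := @rate_local x c; last by exists G.
  by apply: le_lt_trans Fc; apply: ereal_sup_ubound; exists x.
have mK := compl_compact_borel cK.
apply: ltW; apply: (@le_lt_trans _ _ (massL (G `|` ~` K))); last first.
  by apply: massL_setU_lt => //; exact: open_borel.
apply: massL_mono.
- exact: closed_borel.
- by apply: measurableU => //; exact: open_borel.
- by move=> x Fx; have [Kx|Kx] := pselect (K x); [left; apply: KFG|right].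
Qed.

(* The integral of [e^(h/t)], for [h] peaking at [x], is split over [G], over
   [K `\` G], where [h] is small, and over the complement of [K]. *)
Lemma rate_open_ge G x : open G -> G x -> expeR (- J x) <= massl G.
Proof.
move=> oG Gx; apply: le_from_expR; first exact: massl_ge0.
move=> c Gc; rewrite -[(expR c)%:E]/(expeR c%:E) lee_expeR.
(* The slack [d] will absorb the factor 3 of the estimate below. *)
apply/lee_addgt0Pr => d d0; rewrite -EFinD leeNl.
have [K cK LK] := tight_expR c.
have [||h [Bh hx] hK] := @peak_compact R X B x (K `\` G) (- c) B_peak B_cont.
- by rewrite setDE; apply: compact_closedI => //; exact: open_closedC.
- by case.
apply: ereal_sup_ge; eexists; first by exists h.
have lh : lower_semicontinuous (EFin \o h) := continuous_lsc (B_cont Bh).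
suff : lower_Lambda le mu t (EFin \o h) <= (h x + (c + d))%:E.
  rewrite -(Lambda_lower (B_Lambda Bh)).
  case: (lower_Lambda _ _ _ _) => [r||] //; last by move=> _; rewrite /= leey.
  by rewrite -!EFinN -EFinD !lee_fin; lra.
(* Eventually large integrals force the mass of [G] to be eventually at least [expR (c / t a)],
   against the choice of [c]. *)
rewrite lne_le leNgt; apply/negP => /net_liminf_gt Ih.
suff : (expR c)%:E <= massl G by rewrite leNgt Gc.
apply: net_liminf_ge.
have cd : (h x + c < h x + (c + d))%R by lra.
(* Were the mass of [G] smaller, the integral would be at most three times [expR ((h x + c) / t a)]:
   [G] and the complement of [K] contribute through their mass, the rest through the size of [h]. *)
apply: filterS3 Ih (net_limsup_lt LK) (scale_near 3 cd) => a.
rewrite powmass_lt_expR ltNge powint_le_expR => /negP Ia Ka ca.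
rewrite leNgt; apply/negP; rewrite powmass_lt_expR => Ga; apply: Ia.
have mK := compl_compact_borel cK; have mG := open_borel oG.
have mGK : measurable (G `|` ~` K : set (borel X)) by exact: measurableU.
apply: (le_trans (lsc_integral_le (mu a) (b := h x) (b' := h x + c)
  (tV_gt0 a) lh mGK _ _)).
- by move=> y; rewrite lee_fin.
- move=> y /not_orP[Gy /notP Ky]; rewrite lee_fin -[leRHS]/(h x + c)%R.
  by have := hK y (conj Ky Gy); rewrite opprK.
apply: (@le_trans _ _ (3 * expR ((h x + c) / t a))%:E); last by rewrite lee_fin.
apply: (@le_trans _ _ ((expR (h x / t a))%:E * (2 * expR (c / t a))%:E
    + (expR ((h x + c) / t a))%:E)).
  apply: leeD => //; apply: lee_wpmul2l; first by rewrite lee_fin expR_ge0.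
  apply: le_trans (measureU2 _ mG mK) _.
  by rewrite mulr_natl mulr2n EFinD; apply: leeD; exact: ltW.
by rewrite (mulrDl (h x)) expRD -EFinM -EFinD lee_fin; lra.
Qed.

Lemma rate_bounds : ldp_bounds le mu t J.
Proof.
split; [exact: rate_ge0|exact: rate_upper|move=> G oG].
rewrite ge_max massl_ge0/=; apply: ge_ereal_sup => _ [x Gx <-].
exact: rate_open_ge.
Qed.

Lemma rate_ldp : ldp_with_rate le mu t J.
Proof.
exists J; first exact: rate_bounds.
by split => //; exact: rate_lsc.
Qed.

(** * Variational formulas *)

(** The lower half of Varadhan's lemma: [f] exceeds [r - e / 2] on an open neighborhood of [x], of
    mass at least about [expeR (- J x)]. Lower semicontinuity makes it apply to truncations. *)
Lemma sub_lower_Lambda_le f x r : lower_semicontinuous f -> f x = r%:E ->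
  r%:E - lower_Lambda le mu t f <= J x.
Proof.
move=> lf fx.
suff H e : (0 < e)%R -> (r - e)%:E - J x <= lower_Lambda le mu t f.
  case: (J x) (rate_ge0 x) H => [j||] // _; last by move=> _; rewrite leey.
  case: (lower_Lambda _ _ _ _) => [l||] //=.
  - move=> H; apply/lee_addgt0Pr => e e0.
    by have := H e e0; rewrite -?EFinN -?EFinD ?lee_fin; lra.
  - by move=> _; rewrite leNye.
  - by move=> /(_ 1%R ltr01); rewrite leNgt ltNyr.
move=> e0; move: (rate_ge0 x) (@rate_open_ge [set y | (r - e / 2)%:E < f y] x).
case: (J x) => [j||] // _; last by rewrite addeC leNye.
have oG : open [set y | (r - e / 2)%:E < f y] by exact: lsc_open.
rewrite /= fx lte_fin => /(_ oG) /(_ ltac:(lra)) Gj.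
rewrite -?EFinN -?EFinD le_lne; apply: net_liminf_ge.
(* One half of [e] pays for the drop of [f], the other for a strict bound on the mass. *)
have : (expR (- j - e / 2))%:E < massl [set y | (r - e / 2)%:E < f y].
  by apply: lt_le_trans Gj; rewrite lte_fin ltr_expR; lra.
move=> /net_liminf_gt; apply: filterS => a Ga.
apply: le_trans (powint_ge a lf oG (fun x Gx => ltW Gx)).
have -> : (r - e - j = (r - e / 2) + (- j - e / 2))%R by lra.
by rewrite expRD EFinM; apply: lee_wpmul2l (ltW Ga); rewrite lee_fin expR_ge0.
Qed.

(** A functional [E] that is at most [Lambda] on [B] and obeys the Varadhan bound on [A] has
    supremum [J x]; all three are of this kind. *)
Lemma rate_variational (A : set (X -> R)) x : B `<=` A ->
    (forall h, A h -> continuous h) ->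
  [/\ J x = ereal_sup [set (h x)%:E - upper_Lambda le mu t (EFin \o h) | h in A],
      J x = ereal_sup [set (h x)%:E - lower_Lambda le mu t (EFin \o h) | h in A]
    & J x = ereal_sup [set (h x)%:E
                - lim (lower_Lambda le mu t (trunc h M) @[M --> +oo%R]) | h in A]].
Proof.
move=> BA Ac.
have limE h : continuous h -> lim (lower_Lambda le mu t (trunc h M) @[M --> +oo%R]) =
    ereal_sup (range (fun M => lower_Lambda le mu t (trunc h M))).
  move=> ch; apply: cvg_lim => //; apply: nondecreasing_cvge => M N MN.
  apply: lower_Lambda_mono; [exact: trunc_lsc|exact: trunc_lsc|move=> y].
  rewrite /trunc; case: ifPn => hM; last by rewrite leNye.
  by rewrite (lt_le_trans hM MN).
have H (E : (X -> R) -> \bar R) :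
    (forall h, B h -> E h <= Lambda le mu t (EFin \o h)) ->
    (forall h, A h -> (h x)%:E - E h <= J x) ->
    J x = ereal_sup [set (h x)%:E - E h | h in A].
  move=> EB EA; apply/eqP; rewrite eq_le; apply/andP; split.
    apply: ge_ereal_sup => _ [h Bh <-]; apply: ereal_sup_ge.
    by eexists; [by exists h; [exact: BA|]|exact/leeB/EB].
  by apply: ge_ereal_sup => _ [h Ah <-]; exact: EA.
split; apply: H => h Hh.
- by rewrite (Lambda_upper (B_Lambda Hh)).
- apply: (@le_trans _ _ ((h x)%:E - lower_Lambda le mu t (EFin \o h))).
    by apply: leeB => //; exact: lower_le_upper_Lambda.
  exact: (@sub_lower_Lambda_le (EFin \o h) x (h x) (continuous_lsc (Ac h Hh)) erefl).
- by rewrite (Lambda_lower (B_Lambda Hh)).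
- exact: (@sub_lower_Lambda_le (EFin \o h) x (h x) (continuous_lsc (Ac h Hh)) erefl).
- have ch := B_cont Hh; rewrite limE// -(Lambda_lower (B_Lambda Hh)).
  apply: ge_ereal_sup => _ [M _ <-]; apply: lower_Lambda_mono.
  + exact: trunc_lsc.
  + exact: continuous_lsc.
  + by move=> y; rewrite /trunc; case: ifPn => // _; rewrite leNye.
- have ch := Ac h Hh; rewrite limE//.
  (* Any [M > h x] keeps the value at [x], and the limit dominates each term. *)
  have fx : trunc h (h x + 1) x = (h x)%:E by rewrite /trunc ltrDl ltr01.
  apply: (@le_trans _ _ ((h x)%:E - lower_Lambda le mu t (trunc h (h x + 1)))).
    by apply: leeB => //; apply: ereal_sup_ubound; exists (h x + 1)%R.
  by apply: sub_lower_Lambda_le => //; exact: trunc_lsc.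
Qed.

(** * Points where the rate is infinite *)

(** Conditions (i)-(iii) yield infinite rates through this: by the lower bound, [expeR (- J x)] is
    at most the mass of every open neighborhood of [x]. *)
Lemma rate_eqy x :
  (forall c, exists G, [/\ open G, G x & massL G < (expR c)%:E]) -> J x = +oo.
Proof.
move=> H; apply/eqyP => c _; have [G [oG Gx LG]] := H (- c)%R.
have := le_trans (rate_open_ge oG Gx) (net_liminf_le_limsup le_directed _).
move=> /le_lt_trans /(_ LG).
by rewrite -[(expR _)%:E]/(expeR _%:E) lte_expeR EFinN lteN2 => /ltW.
Qed.

Lemma rate_out_tight S x : exponentially_tight_in le mu t S -> ~ S x ->
  J x = +oo.
Proof.
move=> St Sx; apply: rate_eqy => c; have [K [cK KS LK]] := St _ (expR_gt0 c).
exists (~` K); split => //; last by move=> /KS.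
by apply: closed_openC; exact: compact_closed.
Qed.

Lemma rate_l0 x : l0 le mu t x = +oo -> J x = +oo.
Proof.
move=> lx; apply: rate_eqy => c.
have : lne (ereal_inf [set massL G | G in [set G : set X | open G /\ G x]]) < c%:E.
  by rewrite -[X in X < _]oppeK -/(l0 _ _ _ _) lx ltNyr.
by rewrite lne_lt => /ereal_inf_lt[_ [G [oG Gx] <-]]; exists G.
Qed.

(* The sets [{h >= h x - 1/2} `&` K], with [h] peaking at [x] and [K] compact,
   act as small closed neighborhoods of [x], although [X] need not be regular. *)
Lemma rate_out_cover x : cover_condition le mu t -> ~ closure (X0 R X) x ->
  J x = +oo.
Proof.
move=> cov Xx; apply: rate_eqy => c; have [K cK LK] := tight_expR c.
have [||h [Bh _] hK] :=
  @peak_compact R X B x (K `&` closure (X0 R X)) 1 B_peak B_cont.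
- by apply: compact_closedI => //; exact: closed_closure.
- by case.
have hc : continuous h := B_cont Bh.
have oV : open (h @^-1` [set z | (h x - 1 / 2 < z)%R]).
  by apply: open_comp => // z _; exact: hc.
exists (h @^-1` [set z | (h x - 1 / 2 < z)%R]); split => //=; first by lra.
pose F := K `&` h @^-1` [set z | (h x - 1 / 2 <= z)%R].
have cF : closed F.
  apply: closedI; first exact: compact_closed.
  by apply: closed_comp => // z _; exact: hc.
(* [h] is at least [h x - 1/2] on [F] but at most [h x - 1] where [K] meets the closure of [X0].
   Hence the empty family is a cover, and the mass of [F] is below any [eps]. *)
have F0 : F `&` X0 R X `<=` \bigcup_(G in set0) G.
  move=> y [[Ky Fy] Xy]; exfalso.
  by have := hK y (conj Ky (subset_closure Xy)); move: Fy => /=; lra.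
have [D [_ + +]] := cov F set0 _ cF (@sub0set _ _) F0 (expR_gt0 c).
rewrite subset0 => ->; rewrite bigcup_set0 massL_set0 sube0 => LF.
have mK := compl_compact_borel cK.
apply: (@le_lt_trans _ _ (massL (F `|` ~` K))); last first.
  by apply: massL_setU_lt => //; exact: closed_borel.
apply: massL_mono.
- exact: open_borel.
- by apply: measurableU => //; exact: closed_borel.
- move=> y /= Vy; have [Ky|Ky] := pselect (K y); [left|by right].
  by split => //=; exact: ltW.
Qed.

(** * Uniqueness and the formula for the rate in regular spaces *)

Lemma regular_open_nbhd G x : regular_space X -> open G -> G x ->
  exists W, [/\ open W, W x & closure W `<=` G].
Proof.
move=> rX oG Gx; have [V Vx VG] := rX x G (open_nbhs_nbhs (conj oG Gx)).
exists V°; split; first exact: open_interior.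
  by [].
by apply: subset_trans VG; apply: closure_subset; exact: interior_subset.
Qed.

(** [expeR (- l x)] is at most the mass of [W], hence that of its closure, hence the supremum of
    [expeR (- l' y)] over the closure. *)
Lemma ldp_bounds_closure_le (l l' : X -> \bar R) W x c :
  ldp_bounds le mu t l -> ldp_bounds le mu t l' ->
  open W -> W x -> (forall y, closure W y -> c%:E <= l' y) -> c%:E <= l x.
Proof.
move=> [_ _ lG] [_ lF _] oW Wx Wc.
rewrite -leeN2 -lee_expeR; apply: (@le_trans _ _ (sup_exp l W)).
  by rewrite le_max (ereal_sup_ubound _) ?orbT//; exists x.
apply: le_trans (lG _ oW) _.
apply: le_trans (net_liminf_le_limsup le_directed _) _.
apply: (@le_trans _ _ (massL (closure W))).
  apply: massL_mono; first exact: open_borel.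
    by apply: closed_borel; exact: closed_closure.
  exact: subset_closure.
apply: le_trans (lF _ (@closed_closure _ W)) _.
rewrite ge_max expeR_ge0 andTb; apply: ge_ereal_sup => _ [y /Wc Wy <-].
by rewrite lee_expeR leeN2.
Qed.

(** Regularity places the closure of some [W] inside a superlevel set of one rate, and the
    comparison above transfers the level to the other. *)
Lemma rate_unique J' : regular_space X -> ldp_with_rate le mu t J' ->
  forall x, J' x = J x.
Proof.
move=> rX [l lb [J'lsc J'l J'max]] x; have lb' := rate_bounds.
have J'0 : 0 <= J' x.
  apply: (J'max (cst 0)) => [y a /= a0|y]; last by case: lb.
  by exists setT => //; exact: filterT.
apply/eqP; rewrite eq_le; apply/andP; split; rewrite leNgt; apply/negP.
  (* Here [expR c] is a level of the rate, not of a mass. *)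
  move=> /(exists_expR_between (rate_ge0 x))[c [Jc cJ']].
  have [W [oW Wx WG]] := regular_open_nbhd rX (lsc_open (expR c) J'lsc) cJ'.
  suff : (expR c)%:E <= J x by rewrite leNgt Jc.
  apply: (ldp_bounds_closure_le lb' lb oW Wx) => y /WG /= /ltW /le_trans; apply.
  exact: J'l.
move=> /(exists_expR_between J'0)[c [J'c cJ]].
have [W [oW Wx WG]] := regular_open_nbhd rX (lsc_open (expR c) rate_lsc) cJ.
suff : (expR c)%:E <= J' x by rewrite leNgt J'c.
(* The comparison bounds [l], not its regularization [J']; this lower semicontinuous minorant of [l]
   passes the bound on. *)
pose g y : \bar R := if y \in W then (expR c)%:E else 0.
have -> : (expR c)%:E = g x by rewrite /g mem_set.
apply: J'max.
  move=> y a; rewrite /g; case: ifPn => [/set_mem Wy|_] ay.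
    by exists W; [exact: open_nbhs_nbhs|move=> z Wz; rewrite mem_set].
  exists setT; first exact: filterT.
  by move=> z _; apply: lt_le_trans ay _; case: ifPn.
move=> y; rewrite /g; case: ifPn => [/set_mem Wy|_]; last by case: lb.
by apply: (ldp_bounds_closure_le lb lb' oW Wy) => z /WG /= /ltW.
Qed.

(** Otherwise some level [expR c] lies strictly between. The condition bounds the mass of the
    closure of [W] by that of finitely many closures, each below [expR (- expR c)], so the lower
    bound at [x] gives [J x >= expR c]. *)
Lemma inf_rate_cover_le G x : regular_space X -> cover_condition le mu t ->
  open G -> G x -> ereal_inf (J @` (G `&` X0 R X)) <= J x.
Proof.
move=> rX cov oG Gx; rewrite leNgt; apply/negP.
move=> /(exists_expR_between (rate_ge0 x))[c [Jc cinf]].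
have [W [oW Wx WG]] := regular_open_nbhd rX oG Gx.
pose C := [set V : set X | open V /\ massL (closure V) < (expR (- expR c))%:E].
have WC : closure W `&` X0 R X `<=` \bigcup_(V in C) V.
  move=> y [/WG Gy Xy].
  have [|U [oU Uy LU]] := @rate_local y (- expR c)%R.
    rewrite -[(expR (- _))%:E]/(expeR (- (expR c)%:E)) lte_expeR lteN2.
    by apply: lt_le_trans cinf _; apply: ereal_inf_lbound; exists y.
  (* Regularity again, as the condition involves closures of the covering sets. *)
  have [V [oV Vy VU]] := regular_open_nbhd rX oU Uy.
  exists V => //; split => //; apply: le_lt_trans LU; apply: massL_mono => //.
    by apply: closed_borel; exact: closed_closure.
  exact: open_borel.
suff LW : massL (closure W) <= (expR (- expR c))%:E.
  have := le_trans (rate_open_ge oW Wx) (net_liminf_le_limsup le_directed _).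
  move=> /le_trans H; have {}H := H _ (le_trans _ LW).
  suff : (expR c)%:E <= J x by rewrite leNgt Jc.
  rewrite -leeN2 -lee_expeR; apply: H; apply: massL_mono.
  - exact: open_borel.
  - by apply: closed_borel; exact: closed_closure.
  - exact: subset_closure.
apply/lee_addgt0Pr => e e0.
have CO : C `<=` open by move=> V [].
have [D [finD DC]] := cov _ C e (@closed_closure _ W) CO WC e0.
have [mD LD] : measurable (\bigcup_(V in D) closure V : set (borel X)) /\
    massL (\bigcup_(V in D) closure V) < (expR (- expR c))%:E.
  apply: (@finite_bigcup_ind X _ (fun S => measurable (S : set (borel X)) /\
      massL S < (expR (- expR c))%:E)) => //.
  - by split; [exact: measurable0|rewrite massL_set0 lte_fin expR_gt0].
  - move=> S T [mS LS] [mT LT]; split; first exact: measurableU.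
    exact: massL_setU_lt.
  - move=> V /DC[oV LV]; split => //.
    by apply: closed_borel; exact: closed_closure.
have Dfin : massL (\bigcup_(V in D) closure V) \is a fin_num.
  by rewrite ge0_fin_numE ?massL_ge0// (lt_trans LD) ?ltry.
by rewrite lteBlDl// => /ltW /le_trans; apply; rewrite leeD2r// ltW.
Qed.

Lemma rate_regular_formula x :
  (forall G, open G -> G x -> ereal_inf (J @` (G `&` X0 R X)) <= J x) ->
  J x = ereal_sup [set ereal_inf (J @` (G `&` X0 R X)) |
                   G in [set G : set X | open G /\ G x]].
Proof.
move=> H; apply/eqP; rewrite eq_le; apply/andP; split; last first.
  by apply: ge_ereal_sup => _ [G [oG Gx] <-]; exact: H.
rewrite leNgt; apply/negP => /exists_expR_between[|c [sc cJ]].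
  apply: ereal_sup_ge; eexists; first by exists setT; split => //; exact: openT.
  by apply: le_ereal_inf_tmp => _ [y _ <-]; exact: rate_ge0.
have := sc; rewrite ltNge => /negP; apply.
apply: ereal_sup_ge; eexists.
  by exists [set y | (expR c)%:E < J y]; split => //; exact: lsc_open rate_lsc.
by apply: le_ereal_inf_tmp => _ [y [/ltW] + _ <-].
Qed.

Lemma rate_conclusion (A : set (X -> R)) :
  B `<=` A -> (forall h, A h -> continuous h) ->
  [\/ exponentially_tight_in le mu t (X0 R X),
      exponentially_tight_in le mu t setT /\
        (forall x, ~ X0 R X x -> l0 le mu t x = +oo)
    | cover_condition le mu t] ->
  ldp_conclusion le mu t A B.
Proof.
move=> BA Ac cond.
(* Conditions (i) and (ii) both reduce to an infinite rate outside [X0]. *)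
have cond' : (forall x, ~ X0 R X x -> J x = +oo) \/ cover_condition le mu t.
  case: cond => [tX|[_ H]|]; last by right.
    by left => x; exact: rate_out_tight.
  by left => x /H; exact: rate_l0.
exists J; split; first exact: rate_ldp.
- move=> x Xx; case: cond' => [|cov]; last exact: rate_out_cover.
  by apply => /subset_closure.
- by move=> x _; have [? ? ?] := rate_variational x BA Ac.
- move=> rX; split; last by move=> J'; exact: rate_unique.
  move=> x; apply: rate_regular_formula => G oG Gx.
  case: cond' => [H|cov]; last exact: inf_rate_cover_le.
  have [Xx|/H ->] := pselect (X0 R X x); last by rewrite leey.
  by apply: ereal_inf_lbound; exists x.
Qed.

End large_deviations.

(** * Peaks in algebras and in well-separating classes *)

Section peak_classes.
Context (R : realType) (X : Type) (A : set (X -> R)).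

Lemma peaking_bounded_above x h : A h -> (forall y, (h y <= h x)%R) ->
  peaking (bounded_above_part A) x h.
Proof.
by move=> Ah hx; split => //; split => //; exists (h x) => _ [y _ <-].
Qed.

(** Defects [h x - h y] are nonnegative and add up, so the sum has at least the defect of each
    term. *)
Lemma peaking_add (C : set (X -> R)) :
  (forall h1 h2, C h1 -> C h2 -> C (fun x => h1 x + h2 x)%R) ->
  forall x h1 h2, peaking C x h1 -> peaking C x h2 -> exists2 h, peaking C x h &
    forall y, (h y - h x <= h1 y - h1 x)%R /\ (h y - h x <= h2 y - h2 x)%R.
Proof.
move=> CD x h1 h2 [C1 p1] [C2 p2]; exists (fun y => h1 y + h2 y)%R.
  by split; [exact: CD|move=> y; rewrite lerD].
by move=> y; have := p1 y; have := p2 y; split; lra.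
Qed.

Lemma scale_sqr_ge (c d : R) : d != 0%R -> (c <= `|c| / d ^+ 2 * d ^+ 2)%R.
Proof. by move=> d0; rewrite divfK ?ler_norm// expf_neq0. Qed.

Lemma algebra_bounded_above_peak : function_algebra A -> separates_points A ->
  peak_class (bounded_above_part A).
Proof.
move=> [A0 AD AZ AM] Asep; exists (peaking (bounded_above_part A)) => x; split.
- by [].
- by apply: peaking_bounded_above.
- move=> y c /Asep[u Au /eqP uxy]; rewrite -subr_eq0 in uxy.
  (* Makes the defect at [y] equal to the absolute value of [c]. *)
  pose N := (`|c| / (u x - u y) ^+ 2)%R.
  have N0 : (0 <= N)%R by rewrite divr_ge0// sqr_ge0.
  (* This is [N (u x)^2 - N (u x - u z)^2], whose constant terms cancel, as an algebra without unit
     requires. *)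
  pose h z := (- N * (u z * u z) + 2 * N * u x * u z)%R.
  have hE z : (h z = h x - N * (u x - u z) ^+ 2)%R by rewrite /h; ring.
  exists h.
    apply: peaking_bounded_above => [|z].
      by apply: AD; apply: AZ => //; exact: AM.
    by rewrite hE gerBl mulr_ge0// sqr_ge0.
  by rewrite hE lerB// scale_sqr_ge.
- apply: peaking_add => h1 h2 [A1 [b1 ub1]] [A2 [b2 ub2]]; split; first exact: AD.
  exists (b1 + b2)%R => _ [y _ <-].
  by apply: lerD; [apply: ub1; exists y|apply: ub2; exists y].
Qed.

Lemma algebra_nonpositive_peak : function_algebra A -> separates_points A ->
  nowhere_vanishing A -> peak_class (nonpositive_part A).
Proof.
move=> [A0 AD AZ AM] Asep Anv; exists (peaking (nonpositive_part A)) => x; split.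
- by [].
- by split.
- move=> y c xy.
  (* Then [- N g^2] peaks at [x] with value 0. When [u x <> 0], [g] is some [k] corrected by a
     multiple of [u] if [u y = 0], and [u^2 - (u x) u] otherwise. *)
  have [g [Ag gx gy]] : exists g, [/\ A g, g x = 0%R & g y != 0%R].
    have [u Au /eqP uxy] := Asep x y xy.
    have [ux0|ux0] := eqVneq (u x) 0%R.
      by exists u; split => //; rewrite -ux0 eq_sym.
    have [uy0|uy0] := eqVneq (u y) 0%R.
      have [k Ak /eqP ky] := Anv y.
      exists (fun z => k z + (- (k x / u x)) * u z)%R; split.
      - by apply: AD => //; exact: AZ.
      - by rewrite mulNr divfK// subrr.
      - by rewrite uy0 mulr0 addr0.
    exists (fun z => u z * u z + (- u x) * u z)%R; split.
    - by apply: AD; [exact: AM|exact: AZ].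
    - by rewrite mulNr subrr.
    - by rewrite mulNr -mulrBl mulf_neq0// subr_eq0 eq_sym.
  pose N := (`|c| / g y ^+ 2)%R.
  have N0 : (0 <= N)%R by rewrite divr_ge0// sqr_ge0.
  have h0 z : (- N * (g z * g z) <= 0)%R.
    by rewrite mulNr oppr_le0 mulr_ge0// -expr2 sqr_ge0.
  exists (fun z => - N * (g z * g z))%R.
    split; last by move=> z; rewrite gx mulr0 mulr0.
    by split => //; apply: AZ; exact: AM.
  by rewrite gx mulr0 mulr0 sub0r mulNr lerN2 -expr2 scale_sqr_ge.
- apply: peaking_add => h1 h2 [A1 n1] [A2 n2]; split; first exact: AD.
  by move=> y; have := n1 y; have := n2 y; lra.
Qed.

Lemma well_separating_peak : well_separating A ->
  peak_class (bounded_above_part A) /\ peak_class (nonpositive_part A).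
Proof.
move=> [Acst Amin Asep].
(* The common value 0 at [x] makes minima of peaks peak again, and puts [P x] in both classes. *)
pose P x := [set h : X -> R | [/\ A h, h x = 0%R & forall y, (h y <= 0)%R]].
suff HP C : (forall x, P x `<=` peaking C x) -> peak_class C.
  split; apply: HP => x h [Ah hx hn].
    by apply: peaking_bounded_above => // y; rewrite hx.
  by split => // y; rewrite hx.
move=> PC; exists P => x; split => //.
- move=> y c xy; have [g [Ag gx gy]] := Asep x y 0%R (- c)%R xy.
  exists (fun z => Num.min (g z) 0%R).
    split; first exact: Amin.
      by rewrite gx minxx.
    by move=> z; rewrite ge_min lexx orbT.
  by rewrite gx gy minxx sub0r ge_min lexx.
- move=> h1 h2 [A1 x1 n1] [A2 x2 n2].
  exists (fun z => Num.min (h1 z) (h2 z)).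
    split; [exact: Amin|by rewrite x1 x2 minxx|].
    by move=> z; rewrite ge_min n1.
  by move=> z; rewrite x1 x2 minxx !subr0 !ge_min !lexx orbT.
Qed.

End peak_classes.

Theorem theorem1 (R : realType) (X : ptopologicalType)
  (X_not_point : exists x y : X, x <> y)
  (compact_borel : forall K : set X, compact K -> <<s @open X >> K)
  (I : Type) (le : I -> I -> Prop) (le_directed : directed_set le)
  (mu : I -> probability (borel X) R)
  (t : I -> R) (t_gt0 : forall a, (0 < t a)%R)
  (t_cvg0 : t @ net_tails le --> (0 : R)%R)
  (tight : exponentially_tight_in le mu t setT)
  (cond : [\/ exponentially_tight_in le mu t (X0 R X),
              exponentially_tight_in le mu t setT /\
                (forall x, ~ X0 R X x -> l0 le mu t x = +oo)
            | cover_condition le mu t])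
  (A : set (X -> R)) (A_cont : forall h, A h -> continuous h)
  (A_class : (function_algebra A /\ separates_points A) \/ well_separating A) :
  ((forall h, bounded_above_part A h -> Lambda_exists le mu t (EFin \o h)) ->
     ldp_conclusion le mu t A (bounded_above_part A))
  /\
  (nowhere_vanishing A ->
     (forall h, nonpositive_part A h -> Lambda_exists le mu t (EFin \o h)) ->
     ldp_conclusion le mu t A (nonpositive_part A)).
Proof.
split=> [LA|nvA LA].
  apply: rate_conclusion => //.
  - by move=> h [/A_cont].
  - by case: A_class => [[? ?]|/well_separating_peak[]] //;
    first exact: algebra_bounded_above_peak.
  - by move=> h [].
apply: rate_conclusion => //.
- by move=> h [/A_cont].
- by case: A_class => [[? ?]|/well_separating_peak[]] //;
    first exact: algebra_nonpositive_peak.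
- by move=> h [].
Qed.
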